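(* Let $\alpha\in(0,1)$ and $\lambda\in(0,\infty)$. Let $X_0$, $\xi_{k,j}$, $\varepsilon_k$ ($k,j\in\mathbb N$) be independent random variables such that $\mathbb P(\xi_{k,j}=1)=\alpha=1-\mathbb P(\xi_{k,j}=0)$, each $\varepsilon_k$ has a Poisson distribution with parameter $\lambda$, and $X_0$ has a Poisson distribution with expectation $(1-\alpha)^{-1}\lambda$; define $X_k=\sum_{j=1}^{X_{k-1}}\xi_{k,j}+\varepsilon_k$ for $k\in\mathbb N$. Then for every $k\in\mathbb Z_+$ and all $z_0,\ldots,z_k\in\mathbb C$, the joint generator function of $(X_0,X_1,\ldots,X_k)$ takes the form $$F_{0,\ldots,k}(z_0,\ldots,z_k):=\mathbb E(z_0^{X_0}z_1^{X_1}\cdots z_k^{X_k})=\exp\left\{\frac{\lambda}{1-\alpha}\sum_{0\le i\le j\le k}\alpha^{j-i}(z_i-1)z_{i+1}\cdots z_{j-1}(z_j-1)\right\},$$ where, for $i=j$, the term in the sum above is $z_i-1$. Alternatively, $$F_{0,\ldots,k}(z_0,\ldots,z_k)=\exp\left\{\lambda\sum_{0\le i\le j\le k}(1-\alpha)^{K_{i,j,k}}\alpha^{j-i}(z_iz_{i+1}\cdots z_j-1)\right\},$$ where $$K_{i,j,k}:=\begin{cases}-1&\text{if } i=0\text{ and }j=k,\\0&\text{if } i=0\text{ and }0\le j\le k-1,\\0&\text{if }1\le i\le k\text{ and }j=k,\\1&\text{if }1\le i\le j\le k-1.\end{cases}$$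
   Context: $\mathbb N=\{1,2,\dots\}$, $\mathbb Z_+=\{0,1,2,\dots\}$. Conventions: $\sum_{j=1}^0:=0$, empty products equal $1$ (so for $j=i+1$ the term in the first sum is $\alpha(z_i-1)(z_{i+1}-1)$), and $0^0=1$. *)

(* Defs.v *)
From HB Require Import structures.
From mathcomp Require Import all_boot all_order all_algebra.
From mathcomp Require Import finmap.
From mathcomp Require Import all_classical all_reals all_analysis.
From mathcomp Require Import complex.

Set Implicit Arguments.
Unset Strict Implicit.
Unset Printing Implicit Defensive.

Import Order.TTheory GRing.Theory Num.Theory.
Import numFieldNormedType.Exports.

Local Open Scope classical_set_scope.
Local Open Scope ring_scope.
Local Open Scope complex_scope.

Section ComplexValued.
Context {R : realType}.

Definition cexp (w : R[i]) : R[i] :=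
  (expR (complex.Re w) * cos (complex.Im w))
    +i* (expR (complex.Re w) * sin (complex.Im w)).

Context d (T : measurableType d) (P : probability T R).

Definition cintegrable (Z : T -> R[i]) : Prop :=
  P.-integrable setT (fun t => (complex.Re (Z t))%:E) /\
  P.-integrable setT (fun t => (complex.Im (Z t))%:E).

(* Meaningful only when [cintegrable Z] holds, because of [fine]. *)
Definition cexpectation (Z : T -> R[i]) : R[i] :=
  fine 'E_P[fun t => complex.Re (Z t)] +i* fine 'E_P[fun t => complex.Im (Z t)].

End ComplexValued.

Definition mutually_independent {R : realType} d d' (T : measurableType d)
    (T' : measurableType d') (P : probability T R) (I : choiceType)
    (Y : I -> {RV P >-> T'}) : Prop :=
  forall (J : {fset I}) (A : I -> set T'),
    (forall i, i \in J -> measurable (A i)) ->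
    P (\bigcap_(i in [set` J]) Y i @^-1` A i)
      = (\prod_(i <- J) P (Y i @^-1` A i))%E.

Definition poisson_distributed {R : realType} d (T : measurableType d)
    (P : probability T R) (Y : {RV P >-> nat}) (rate : R) : Prop :=
  forall n : nat, distribution P Y [set n] = (poisson_pmf rate n)%:E.

(* The innovations and the thinning variables are indexed from 0:
   [eps k] is \varepsilon_{k+1} and [xi k j] is \xi_{k+1,j+1}. *)

Definition inar_inputs {R : realType} d (T : measurableType d)
    (P : probability T R) (X0 : {RV P >-> nat})
    (xi : nat -> nat -> {RV P >-> nat}) (eps : nat -> {RV P >-> nat})
    (i : option (nat * nat + nat)) : {RV P >-> nat} :=
  match i with
  | None => X0
  | Some (inl (k, j)) => xi k j
  | Some (inr k) => eps k
  end.

Fixpoint inar (T : Type) (X0 : T -> nat) (xi : nat -> nat -> T -> nat)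
    (eps : nat -> T -> nat) (k : nat) (t : T) : nat :=
  match k with
  | 0 => X0 t
  | l.+1 => (\sum_(j < inar X0 xi eps l t) xi l j t + eps l t)%N
  end.

Section GeneratorFunction.
Context {R : realType} d (T : measurableType d) (P : probability T R).
Variables (X : nat -> T -> nat) (k : nat) (z : 'I_k.+1 -> R[i]).

Definition joint_monomial (t : T) : R[i] := \prod_(i < k.+1) z i ^+ X i t.

Definition joint_generator : R[i] := cexpectation P joint_monomial.

End GeneratorFunction.

(* (z_i - 1) z_{i+1} ... z_{j-1} (z_j - 1), read as z_i - 1 when i = j. *)
Definition chain_term {R : realType} (k : nat) (z : 'I_k.+1 -> R[i])
    (i j : 'I_k.+1) : R[i] :=
  if i == j then z i - 1
  else (z i - 1) * (\prod_(l < k.+1 | (i < l < j)%N) z l) * (z j - 1).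

(* Used only for i <= j <= k. *)
Definition Kexp (i j k : nat) : int :=
  if i == 0%N then (if j == k then -1 else 0)
  else (if j == k then 0 else 1).

(* Main.v *)
Require Import Defs.
From HB Require Import structures.
From mathcomp Require Import all_boot all_order all_algebra.
From mathcomp Require Import finmap.
From mathcomp Require Import all_classical all_reals all_analysis.
From mathcomp Require Import complex.
From mathcomp Require Import measurable_realfun ring lra.

Set Implicit Arguments.
Unset Strict Implicit.
Unset Printing Implicit Defensive.

Import Order.TTheory GRing.Theory Num.Theory.
Import numFieldNormedType.Exports.

Local Open Scope classical_set_scope.
Local Open Scope ring_scope.
Local Open Scope complex_scope.

(** The generating function is computed one time step at a time, by conditioning
on the past. Given the history [X 0, ..., X k], the value [X k.+1] is a sum of
[X k] independent Bernoulli variables and one Poisson variable, so inserting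
the factor [w ^+ X k.+1] into an expectation amounts to inserting
[(1 + alpha (w - 1)) ^+ X k] and multiplying by [exp (lambda (w - 1))]. The first
factor is absorbed by the variable [z k], which becomes
[z k * (1 + alpha (w - 1))]; the expectation of a monomial in [X 0, ..., X k.+1]
is thereby reduced to that of a monomial in [X 0, ..., X k]
([transition_generator]). Iterating from the Poisson law of [X 0] gives
  [E = exp (lambda / (1 - alpha) * \sum_(j <= k) D j * (z j - 1))],
where [D 0 = 1] and [D j.+1 = alpha * z j * D j + (1 - alpha)]
([monomial_expectation]; [D] is called [weight]). The two closed formulas are
two expansions of this exponent: solving the recursion for [D] gives the sum of
[chain_term]s ([weight_chains]), and solving it for [z j * D j] gives the sum over
blocks [z i ... z j] ([weight_sum_blocks]).

Three points need care.
- The number of summands in [X k.+1] is random and belongs to the past. The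
  expectation is therefore cut along the events [X k = n], on which the sum has
  [n] terms ([transition_on_fiber], [eq_cexpectation_fibers]). The past is carried
  by the whole sequence [history k], a variable with countably many values, and
  its independence from the inputs still to come ([history_independent]) follows
  from the mutual independence of the inputs by countable additivity.
- Integrability is part of the claim. Cutting along the events [X k = n] is
  harmless for nonnegative integrands, so it is obtained by running the same
  recursion with [normc (z i)] in place of [z i].
- The Poisson generating function at a complex point is the power series of
  the exponential, whereas [cexp] is given by [expR], [cos] and [sin];
  [cvg_Re_exp_series] identifies the two through a differential equation. *)

Local Notation Re := complex.Re.
Local Notation Im := complex.Im.
Local Notation normc := Normc.normc.

(** * The complex exponential as a power series *)
Section ComplexExponential.
Context {R : realType}.
Implicit Types a b w : R[i].

Lemma Re_mulc a b : Re (a * b) = Re a * Re b - Im a * Im b.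
Proof. by case: a b => [? ?] [? ?]. Qed.

Lemma Im_mulc a b : Im (a * b) = Re a * Im b + Im a * Re b.
Proof. by case: a b => [? ?] [? ?]. Qed.

Lemma Re_addc a b : Re (a + b) = Re a + Re b.
Proof. by case: a b => [? ?] [? ?]. Qed.

Lemma Re_scalec (r : R) a : Re (r%:C * a) = r * Re a.
Proof. by case: a => ? ? /=; rewrite mul0r subr0. Qed.

Lemma eq_ReIm a b : Re a = Re b -> Im a = Im b -> a = b.
Proof. by case: a b => [? ?] [? ?] /= -> ->. Qed.

Lemma cexpD a b : cexp (a + b) = cexp a * cexp b.
Proof.
case: a b => [x y] [u v]; apply: eq_ReIm => /=; rewrite expRD ?cosD ?sinD; ring.
Qed.

Lemma cexp_real (r : R) : cexp r%:C = (expR r)%:C.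
Proof. by apply: eq_ReIm => /=; rewrite ?cos0 ?sin0 ?mulr1 ?mulr0. Qed.

Lemma norm_Re_le_normc a : `|Re a| <= normc a.
Proof.
case: a => x y /=; rewrite -sqrtr_sqr ler_wsqrtr// lerDl sqr_ge0 //.
Qed.

Lemma norm_Im_le_normc a : `|Im a| <= normc a.
Proof.
case: a => x y /=; rewrite -sqrtr_sqr ler_wsqrtr// lerDr sqr_ge0 //.
Qed.

Lemma normc_ge0 a : 0 <= normc a.
Proof. by case: a => x y; exact: sqrtr_ge0. Qed.

Lemma normcX a n : normc (a ^+ n) = normc a ^+ n.
Proof.
elim: n => [|n ih]; first by rewrite !expr0 Normc.normc1.
by rewrite !exprS Normc.normcM ih.
Qed.

(** The factor [b] serves two purposes: [b = 1] and [b = - 'i] give the real and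
the imaginary part of the exponential series of [a], and multiplying [b] by [a]
is differentiation, so that the whole family is closed under it. *)
Definition twisted_exp_coeff a b (n : nat) : R := Re (b * a ^+ n) / n`!%:R.

Lemma is_cvg_twisted_exp a b (x : R) :
  cvgn (pseries (twisted_exp_coeff a b) x).
Proof.
apply: normed_cvg.
apply: (@series_le_cvg _ _ (fun n => normc b * exp_coeff (normc a * `|x|) n)).
- by move=> n /=.
- move=> n; rewrite mulr_ge0 ?normc_ge0// exp_coeff_ge0// mulr_ge0 ?normc_ge0//.
- move=> n /=; rewrite /twisted_exp_coeff /exp_coeff /= exprMn.
  rewrite 2!normrM normfV normrX (ger0_norm (ler0n _ _)).
  rewrite mulrAC !mulrA ler_wpM2r ?invr_ge0// ler_wpM2r// ?exprn_ge0//.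
  by rewrite (le_trans (norm_Re_le_normc _))// Normc.normcM normcX.
- exact/is_cvg_seriesZ/is_cvg_series_exp_coeff.
Qed.

Lemma pseries_diffs_twisted a b :
  pseries_diffs (twisted_exp_coeff a b) = twisted_exp_coeff a (b * a).
Proof.
apply/funext => n; rewrite /pseries_diffs /twisted_exp_coeff.
by rewrite factS natrM invfM mulrCA mulVKf// exprS mulrA.
Qed.

Definition twisted_exp a b (x : R) : R :=
  limn (pseries (twisted_exp_coeff a b) x).

Lemma is_derive_twisted_exp a b (x : R) :
  is_derive x (1 : R) (twisted_exp a b) (twisted_exp a (b * a) x).
Proof.
rewrite /twisted_exp -pseries_diffs_twisted.
apply: (@pseries_snd_diffs _ _ (`|x| + 1)); rewrite ?pseries_diffs_twisted.
- exact: is_cvg_twisted_exp.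
- exact: is_cvg_twisted_exp.
- exact: is_cvg_twisted_exp.
- by rewrite [ltRHS]ger0_norm ?addr_ge0// ltrDl.
Qed.

Lemma twisted_expD a b c (r s x : R) :
  twisted_exp a (r%:C * b + s%:C * c) x =
    r * twisted_exp a b x + s * twisted_exp a c x.
Proof.
rewrite /twisted_exp; apply/cvg_lim => //.
have cvb := @is_cvg_twisted_exp a b x; have cvc := @is_cvg_twisted_exp a c x.
rewrite [X in X @ _ --> _](_ : _ = (fun n =>
    r * pseries (twisted_exp_coeff a b) x n +
    s * pseries (twisted_exp_coeff a c) x n)).
  by apply: cvgD; apply: cvgM => //; exact: cvg_cst.
apply/funext => n.
rewrite /pseries /series /= !mulr_sumr -big_split/=.
apply: eq_bigr => i _; rewrite /twisted_exp_coeff.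
rewrite mulrDl -2!(mulrA _ _ (a ^+ i)) Re_addc 2!Re_scalec; ring.
Qed.

Lemma twisted_exp0 a b : twisted_exp a b 0 = Re b.
Proof.
rewrite /twisted_exp; apply/cvg_lim => //.
rewrite -(cvg_shiftS (pseries _ _)).
rewrite (_ : (fun _ => _) = cst (Re b)); first exact: cvg_cst.
apply/funext => n; rewrite /pseries /series /= big_nat_recl// big1 ?addr0.
  by rewrite /twisted_exp_coeff !expr0 !mulr1 fact0 divr1.
by move=> i _; rewrite exprS mul0r mulr0.
Qed.

(** Multiplying the series by [exp (- t a)], written with real functions, gives a
function of [t] with zero derivative, hence equal to its value at [0]. *)
Lemma twisted_exp_rotate a b (t : R) :
  expR (- Re a * t) * (cos (Im a * t) * twisted_exp a b t
                     + sin (Im a * t) * twisted_exp a (- 'i%C * b) t) = Re b.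
Proof.
pose h (t : R) : R :=  expR (- Re a * t) * (cos (Im a * t) * twisted_exp a b t
                     + sin (Im a * t) * twisted_exp a (- 'i%C * b) t).
rewrite -/(h t) (_ : Re b = h 0); last first.
  by rewrite /h !mulr0 expR0 cos0 sin0 twisted_exp0; ring.
apply: is_derive_0_is_cst => x; rewrite /h.
have d1 := @is_derive_twisted_exp a b x.
have d2 := @is_derive_twisted_exp a (- 'i%C * b) x.
apply: is_derive_eq.
have -> : b * a = (Re a)%:C * b + (- Im a)%:C * (- 'i%C * b).
  by clear; case: a b => [? ?] [? ?]; apply: eq_ReIm => /=; ring.
have -> : - 'i%C * b * a = (Re a)%:C * (- 'i%C * b) + (Im a)%:C * b.
  by clear; case: a b => [? ?] [? ?]; apply: eq_ReIm => /=; ring.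
rewrite 2!twisted_expD /GRing.scale /=; ring.
Qed.

(** The two instances [b] and [- 'i * b] of [twisted_exp_rotate] form a linear
system whose matrix is, up to scaling, a rotation; [cos2Dsin2] inverts it. *)
Lemma twisted_expE a b (t : R) : twisted_exp a b t = Re (b * cexp (t%:C * a)).
Proof.
have h1 := twisted_exp_rotate a b t.
have := twisted_exp_rotate a (- 'i%C * b) t.
have -> : - 'i%C * (- 'i%C * b) = (-1)%:C * b + 0%:C * b.
  by case: b {h1} => [? ?]; apply: eq_ReIm => /=; ring.
rewrite twisted_expD mulN1r mul0r addr0 => h2.
have ee : expR (Re a * t) * expR (- Re a * t) = 1.
  by rewrite mulNr expRxMexpNx_1.
have -> : Re (b * cexp (t%:C * a)) = expR (Re a * t) *
   (cos (Im a * t) * Re b - sin (Im a * t) * Re (- 'i%C * b)).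
  rewrite /cexp; case: a b {h1 h2 ee} => [x y] [u v] /=.
  rewrite !(mul0r, subr0, addr0) !(mulrC t); ring.
rewrite -h1 -h2; have := cos2Dsin2 (Im a * t).
set c := cos _; set s := sin _; set q := twisted_exp a b t.
set q' := twisted_exp a _ t => cs.
transitivity ((expR (Re a * t) * expR (- Re a * t)) * ((c ^+ 2 + s ^+ 2) * q)).
  by rewrite ee cs !mul1r.
ring.
Qed.

Lemma cvg_Re_exp_series a b :
  series (fun n => Re (b * a ^+ n) / n`!%:R) @ \oo --> Re (b * cexp a).
Proof.
rewrite -[a in cexp a]mul1r -(twisted_expE a b 1).
rewrite [X in X @ _ --> _](_ : _ = pseries (twisted_exp_coeff a b) 1).
  exact: is_cvg_twisted_exp.
apply/funext => n; apply: eq_bigr => i _.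
by rewrite /= expr1n mulr1.
Qed.

End ComplexExponential.

(** * Expectations over independent variables *)
Section IndependentProduct.
Local Open Scope ereal_scope.
Context {R : realType} d (T : measurableType d) (P : probability T R).

(** Independence says that the law of the pair [(F, G)] agrees with the product of
the two laws on rectangles, hence everywhere; Fubini does the rest. *)
Lemma independent_product (F G : T -> R) :
    (forall A B : set R, measurable A -> measurable B ->
      P (F @^-1` A `&` G @^-1` B) = P (F @^-1` A) * P (G @^-1` B)) ->
    P.-integrable setT (EFin \o F) -> P.-integrable setT (EFin \o G) ->
  P.-integrable setT (fun t => (F t * G t)%:E) /\
  \int[P]_t (F t * G t)%:E = (\int[P]_t (F t)%:E) * (\int[P]_t (G t)%:E).
Proof.
move=> indep iF iG.
have mF : measurable_fun setT F by exact/measurable_EFinP/(measurable_int _ iF).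
have mG : measurable_fun setT G by exact/measurable_EFinP/(measurable_int _ iG).
pose F' : {mfun T >-> R} := HB.pack F (isMeasurableFun.Build _ _ _ _ F mF).
pose G' : {mfun T >-> R} := HB.pack G (isMeasurableFun.Build _ _ _ _ G mG).
pose FG t := (F t, G t).
have mFG : measurable_fun setT FG by exact: measurable_fun_pair.
pose H' : {mfun T >-> (R * R)%type} :=
  HB.pack FG (isMeasurableFun.Build _ _ _ _ FG mFG).
pose m1 := distribution P F'; pose m2 := distribution P G'.
have prodE A : measurable A -> (m1 \x m2) A = distribution P H' A.
  by move=> mA; apply: product_measure_unique.
pose f (z : R * R) : \bar R := (z.1 * z.2)%:E.
have mf : measurable_fun setT f.
  by apply/measurable_EFinP; exact: measurable_funM.
have mn : measurable_fun setT (fun x : R => `|x|%:E).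
  by apply/measurable_EFinP; exact: normr_measurable.
have iE : \int[m1]_x \int[m2]_y `|f (x, y)| =
    (\int[P]_t `|(F t)%:E|) * (\int[P]_t `|(G t)%:E|).
  transitivity (\int[m1]_x (`|x|%:E * \int[m2]_y `|y|%:E)).
    apply: eq_integral => x _; rewrite -ge0_integralZl//.
    by apply: eq_integral => y _; rewrite /f /= normrM EFinM.
  rewrite ge0_integralZr//; last exact: integral_ge0.
  by rewrite /m1 /m2 !ge0_integral_distribution.
have ifm : (m1 \x m2).-integrable setT f.
  apply/integrable12ltyP => //; rewrite iE.
  have /integrableP[_ ltF] := iF; have /integrableP[_ ltG] := iG.
  by rewrite lte_mul_pinfty// ?integral_ge0// ge0_fin_numE// integral_ge0.
have iH : P.-integrable setT (f \o H').
  apply/integrableP; split; first exact: measurableT_comp.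
  have /integrableP[_] := ifm; apply: le_lt_trans.
  rewrite (eq_measure_integral (distribution P H')); last first.
    by move=> A mA _; exact: prodE.
  by rewrite ge0_integral_distribution//; exact: measurableT_comp.
split; first exact: iH.
rewrite -(integral_distribution (X := H') mf iH).
transitivity (\int[m1 \x m2]_z f z).
  by apply: eq_measure_integral => A mA _; exact/esym/prodE.
rewrite -integral12_prod_meas1//.
have mE : measurable_fun setT (EFin : R -> \bar R) by exact/measurable_EFinP.
have im1 : m1.-integrable setT (EFin : R -> \bar R).
  exact: (integrable_pushforward mF mE).
have im2 : m2.-integrable setT (EFin : R -> \bar R).
  exact: (integrable_pushforward mG mE).
rewrite -(integral_distribution (X := F') mE iF).
rewrite -(integral_distribution (X := G') mE iG).
rewrite -/m1 -/m2 -(fineK (integrable_fin_num _ im2))//.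
rewrite -integralZr//; apply: eq_integral => x _.
rewrite fineK ?integrable_fin_num// /fubini_F.
by rewrite -integralZl.
Qed.

End IndependentProduct.

Section DiscreteExpectation.
Context {R : realType} d (T : measurableType d) (P : probability T R).

Lemma trivIset_fibers (N : T -> nat) : trivIset setT (fun n => N @^-1` [set n]).
Proof.
apply/trivIsetP => i j _ _ /eqP ij; apply/seteqP; split=> t //= [iE jE].
by case: ij; rewrite -iE.
Qed.

Lemma bigcup_fibers (N : T -> nat) : \bigcup_n (N @^-1` [set n]) = setT.
Proof. by apply/seteqP; split=> t //= _; exists (N t). Qed.

Lemma measurable_nat_comp d' (T' : measurableType d') (N : T -> nat)
    (g : nat -> T') :
  (forall n, measurable (N @^-1` [set n])) -> measurable_fun setT (g \o N).
Proof.
move=> mN _ B mB; rewrite setTI.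
rewrite (_ : _ @^-1` B = \bigcup_(n in g @^-1` B) (N @^-1` [set n])).
  exact: bigcup_measurable.
apply/seteqP; split=> [t /= Bt|t [n /= Bn nE]]; first by exists (N t).
by rewrite /preimage /= nE.
Qed.

Lemma ge0_integral_fibers (N : T -> nat) (F : T -> \bar R) :
    (forall n, measurable (N @^-1` [set n])) -> measurable_fun setT F ->
    (forall t, 0 <= F t)%E ->
  (\int[P]_t F t = \sum_(n <oo) \int[P]_(t in N @^-1` [set n]) F t)%E.
Proof.
move=> mN mF F0; rewrite -[in LHS](bigcup_fibers N) ge0_integral_bigcup//.
  by rewrite bigcup_fibers.
exact: trivIset_fibers.
Qed.

Lemma integral_fibers (N : T -> nat) (F : T -> \bar R) :
    (forall n, measurable (N @^-1` [set n])) -> P.-integrable setT F ->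
  (\int[P]_t F t = \sum_(n <oo) \int[P]_(t in N @^-1` [set n]) F t)%E.
Proof.
move=> mN iF; rewrite -[in LHS](bigcup_fibers N) integral_bigcup//.
  exact: trivIset_fibers.
by rewrite bigcup_fibers.
Qed.

(** Absolute convergence makes the integral the sum of its restrictions to the
fibers of [V]. *)
Lemma law_expectation (V : T -> nat) (p g : nat -> R) :
    (forall n, measurable (V @^-1` [set n])) ->
    (forall n, P (V @^-1` [set n]) = (p n)%:E) ->
    cvgn (series (fun n => `|g n| * p n)) ->
  P.-integrable setT (fun t => (g (V t))%:E) /\
  series (fun n => g n * p n) @ \oo --> fine (\int[P]_t (g (V t))%:E).
Proof.
move=> mV pV cv.
have p0 n : 0 <= p n by rewrite -lee_fin -pV.
have fiberE (h : nat -> R) n :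
    (\int[P]_(t in V @^-1` [set n]) (h (V t))%:E = (h n * p n)%:E)%E.
  rewrite (eq_integral (cst (h n)%:E)); last by move=> t /set_mem /= ->.
  by rewrite integral_cst// EFinM; congr (_ * _)%E; exact: pV.
have seriesE (u : nat -> R) : cvgn (series u) ->
    (\sum_(n <oo) (u n)%:E)%E = (limn (series u))%:E.
  move=> cvu; rewrite -EFin_lim//; apply/congr_lim/funext => n /=.
  by rewrite /series /= sumEFin.
have mg (h : nat -> R) : measurable_fun setT (fun t => (h (V t))%:E).
  by apply/measurable_EFinP; exact: (measurable_nat_comp h).
have ig : P.-integrable setT (fun t => (g (V t))%:E).
  apply/integrableP; split; first exact: mg.
  rewrite (ge0_integral_fibers (N := V)) //=; last exact: (mg (fun n => `|g n|)).
  under eq_eseriesr => n _ do rewrite (fiberE (fun n => `|g n|)).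
  by rewrite seriesE// ltry.
split=> //.
rewrite (integral_fibers mV)//.
under eq_eseriesr => n _ do rewrite fiberE.
have cvg : cvgn (series (fun n => g n * p n)).
  apply: normed_cvg; rewrite /normed_series_of /=.
  by under eq_fun => n do rewrite normrM (ger0_norm (p0 n)).
by rewrite seriesE.
Qed.

End DiscreteExpectation.

Section ComplexExpectation.
Context {R : realType} d (T : measurableType d) (P : probability T R).
Implicit Types (Z W : T -> R[i]) (c : R[i]).

Lemma cexpectationE Z : cexpectation P Z =
  fine (\int[P]_t (Re (Z t))%:E) +i* fine (\int[P]_t (Im (Z t))%:E).
Proof. by rewrite /cexpectation unlock. Qed.

Lemma Re_cexpectation Z :
  Re (cexpectation P Z) = Rintegral P setT (fun t => Re (Z t)).
Proof. by rewrite cexpectationE. Qed.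

Lemma Im_cexpectation Z :
  Im (cexpectation P Z) = Rintegral P setT (fun t => Im (Z t)).
Proof. by rewrite cexpectationE. Qed.

Lemma cintegrableZ c Z : cintegrable P Z -> cintegrable P (fun t => c * Z t).
Proof.
move=> [iRe iIm]; split.
- rewrite (_ : (fun _ => _) = (fun t =>
      (Re c)%:E * (Re (Z t))%:E - (Im c)%:E * (Im (Z t))%:E)%E).
    by apply: integrableB => //; exact: integrableZl.
  by apply/funext => t; rewrite Re_mulc EFinB !EFinM.
- rewrite (_ : (fun _ => _) = (fun t =>
      (Re c)%:E * (Im (Z t))%:E + (Im c)%:E * (Re (Z t))%:E)%E).
    by apply: integrableD => //; exact: integrableZl.
  by apply/funext => t; rewrite Im_mulc EFinD !EFinM.
Qed.

Lemma cexpectationZ c Z : cintegrable P Z ->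
  cexpectation P (fun t => c * Z t) = c * cexpectation P Z.
Proof.
move=> [iRe iIm].
have fZl (r : R) (F : T -> R) : P.-integrable setT (fun t => (F t)%:E) ->
   P.-integrable setT (fun t => (r * F t)%:E).
  by move=> iF; under eq_fun do rewrite EFinM; exact: integrableZl.
apply: eq_ReIm.
- rewrite Re_cexpectation Re_mulc Re_cexpectation Im_cexpectation.
  under eq_Rintegral do rewrite Re_mulc.
  by rewrite RintegralB ?RintegralZl//; exact: fZl.
- rewrite Im_cexpectation Im_mulc Re_cexpectation Im_cexpectation.
  under eq_Rintegral do rewrite Im_mulc.
  by rewrite RintegralD ?RintegralZl//; exact: fZl.
Qed.

(** Independence is asked for all subsets of [C1] and [C2], without measurable
structure on them: the variables [U] and [V] used below are discrete. *)
Lemma cexpectation_independent (C1 C2 : Type) (U : T -> C1) (V : T -> C2)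
    (f : C1 -> R[i]) (g : C2 -> R[i]) :
    (forall A B, P (U @^-1` A `&` V @^-1` B) = (P (U @^-1` A) * P (V @^-1` B))%E) ->
    cintegrable P (f \o U) -> cintegrable P (g \o V) ->
  cintegrable P (fun t => f (U t) * g (V t)) /\
  cexpectation P (fun t => f (U t) * g (V t)) =
    cexpectation P (f \o U) * cexpectation P (g \o V).
Proof.
move=> indep [fRe fIm] [gRe gIm].
have prodE (u : C1 -> R) (v : C2 -> R) :
    P.-integrable setT (fun t => (u (U t))%:E) ->
    P.-integrable setT (fun t => (v (V t))%:E) ->
    P.-integrable setT (fun t => (u (U t) * v (V t))%:E) /\
    Rintegral P setT (fun t => u (U t) * v (V t)) =
      Rintegral P setT (fun t => u (U t)) * Rintegral P setT (fun t => v (V t)).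
  move=> iu iv.
  have [] := @independent_product _ _ _ P (u \o U) (v \o V) _ iu iv.
    by move=> A B _ _; exact: (indep (u @^-1` A) (v @^-1` B)).
  move=> iuv uvE; split=> //.
  by rewrite /Rintegral uvE fineM//; exact: integrable_fin_num.
have [iRR RR] := prodE (fun x => Re (f x)) (fun x => Re (g x)) fRe gRe.
have [iII II] := prodE (fun x => Im (f x)) (fun x => Im (g x)) fIm gIm.
have [iRI RI] := prodE (fun x => Re (f x)) (fun x => Im (g x)) fRe gIm.
have [iIR IR] := prodE (fun x => Im (f x)) (fun x => Re (g x)) fIm gRe.
split.
- split.
  + by under eq_fun do rewrite Re_mulc EFinB; exact: integrableB.
  + by under eq_fun do rewrite Im_mulc EFinD; exact: integrableD.
- apply: eq_ReIm; rewrite ?(Re_mulc, Im_mulc) ?(Re_cexpectation, Im_cexpectation).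
  + under eq_Rintegral do rewrite Re_mulc.
    by rewrite RintegralB// [X in X - _]RR [X in _ - X]II.
  + under eq_Rintegral do rewrite Im_mulc.
    by rewrite RintegralD// [X in X + _]RI [X in _ + X]IR.
Qed.

Lemma law_cexpectation (V : T -> nat) (p : nat -> R) (g : nat -> R[i]) (L : R[i]) :
    (forall n, measurable (V @^-1` [set n])) ->
    (forall n, P (V @^-1` [set n]) = (p n)%:E) ->
    cvgn (series (fun n => normc (g n) * p n)) ->
    series (fun n => Re (g n) * p n) @ \oo --> Re L ->
    series (fun n => Im (g n) * p n) @ \oo --> Im L ->
  cintegrable P (g \o V) /\ cexpectation P (g \o V) = L.
Proof.
move=> mV pV cg cRe cIm.
have p0 n : 0 <= p n by rewrite -lee_fin -pV.
have cvg_of (h : nat -> R) : (forall n, `|h n| <= normc (g n)) ->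
    cvgn (series (fun n => `|h n| * p n)).
  move=> hg; apply: series_le_cvg cg.
  - by move=> n; exact: mulr_ge0.
  - by move=> n; rewrite mulr_ge0// normc_ge0.
  - by move=> n; exact: ler_wpM2r.
have [iRe ERe] := law_expectation mV pV
  (cvg_of (fun x => Re (g x)) (fun n => norm_Re_le_normc _)).
have [iIm EIm] := law_expectation mV pV
  (cvg_of (fun x => Im (g x)) (fun n => norm_Im_le_normc _)).
split; first by split.
rewrite cexpectationE; apply: eq_ReIm => /=.
- exact: (cvg_unique _ ERe cRe).
- exact: (cvg_unique _ EIm cIm).
Qed.

Lemma cvg_series_two_terms (u : nat -> R) : (forall n, u n.+2 = 0) ->
  series u @ \oo --> u 0%N + u 1%N.
Proof.
move=> u0; rewrite -(cvg_shiftn 2).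
rewrite (_ : (fun _ => _) = cst (u 0%N + u 1%N)); first exact: cvg_cst.
apply/funext => n; rewrite /series /= addn2 !big_nat_recl// big1 ?addr0//.
Qed.

(** The two given probabilities add up to [1], so every other value of [V] has
probability [0]. *)
Lemma bernoulli_generator (V : T -> nat) (alpha : R) (w : R[i]) :
    (forall n, measurable (V @^-1` [set n])) ->
    P (V @^-1` [set 1%N]) = alpha%:E -> P (V @^-1` [set 0%N]) = (1 - alpha)%:E ->
  cintegrable P (fun t => w ^+ V t) /\
  cexpectation P (fun t => w ^+ V t) = 1 + alpha%:C * (w - 1).
Proof.
move=> mV p1 p0.
pose p n : R := if n is n'.+1 then if n' is 0%N then alpha else 0 else 1 - alpha.
have pE n : P (V @^-1` [set n]) = (p n)%:E.
  case: n => [//|[//|n]] /=.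
  apply/eqP; rewrite eq_le measure_ge0 andbT.
  have : (P (V @^-1` [set 0%N] `|` V @^-1` [set 1%N] `|` V @^-1` [set n.+2]) <= 1)%E.
    by apply: probability_le1; do 2 apply: measurableU => //.
  rewrite measureU//; last 2 first.
    exact: measurableU.
    by apply/seteqP; split=> t //= -[] [] ->.
  rewrite measureU//; last by apply/seteqP; split=> t //= -[] ->.
  rewrite [X in (X + _ + _)%E]p0 [X in (_ + X + _)%E]p1 -EFinD subrK.
  by rewrite addeC -leeBrDr// subee.
apply: (law_cexpectation (g := fun n => w ^+ n) mV pE).
- by apply/cvg_ex; eexists; apply: cvg_series_two_terms => n; rewrite mulr0.
- have -> : Re (1 + alpha%:C * (w - 1)) = Re (w ^+ 0) * p 0%N + Re (w ^+ 1) * p 1%N.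
    by rewrite expr0 expr1 /p; case: w => x y /=; ring.
  by apply: (@cvg_series_two_terms (fun n => Re (w ^+ n) * p n)) => n; rewrite mulr0.
- have -> : Im (1 + alpha%:C * (w - 1)) = Im (w ^+ 0) * p 0%N + Im (w ^+ 1) * p 1%N.
    by rewrite expr0 expr1 /p; case: w => x y /=; ring.
  by apply: (@cvg_series_two_terms (fun n => Im (w ^+ n) * p n)) => n; rewrite mulr0.
Qed.

Lemma poisson_generator (V : T -> nat) (lambda : R) (w : R[i]) : 0 < lambda ->
    (forall n, measurable (V @^-1` [set n])) ->
    (forall n, P (V @^-1` [set n]) = (poisson_pmf lambda n)%:E) ->
  cintegrable P (fun t => w ^+ V t) /\
  cexpectation P (fun t => w ^+ V t) = cexp (lambda%:C * (w - 1)).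
Proof.
move=> l0 mV pV.
have pE n : poisson_pmf lambda n = lambda ^+ n / n`!%:R * expR (- lambda).
  by rewrite /poisson_pmf l0.
have ImE (x : R[i]) : Im x = Re (- 'i%C * x) by case: x => x y /=; ring.
have cE : cexp (lambda%:C * (w - 1)) = (expR (- lambda))%:C * cexp (lambda%:C * w).
  by rewrite -cexp_real -cexpD mulrBr mulr1 addrC rmorphN.
have termE b : (fun n => Re (b * w ^+ n) * poisson_pmf lambda n) =
    (fun n => Re (b * (expR (- lambda))%:C * (lambda%:C * w) ^+ n) / n`!%:R).
  apply/funext => n; rewrite pE exprMn -rmorphXn.
  rewrite (_ : b * _ * _ = (expR (- lambda) * lambda ^+ n)%:C * (b * w ^+ n)).
    by rewrite Re_scalec; ring.
  by rewrite rmorphM /=; ring.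
apply: (law_cexpectation (g := fun n => w ^+ n) mV pV).
- apply: (@series_le_cvg _ _
    (fun n => expR (- lambda) * exp_coeff (lambda * normc w) n)).
  + move=> n; rewrite mulr_ge0 ?normc_ge0// poisson_pmf_ge0//.
  + move=> n; rewrite mulr_ge0 ?expR_ge0// exp_coeff_ge0//.
    by rewrite mulr_ge0 ?normc_ge0// ltW.
  + move=> n; rewrite normcX pE /exp_coeff /= exprMn le_eqVlt; apply/orP; left.
    by apply/eqP; ring.
  + exact/is_cvg_seriesZ/is_cvg_series_exp_coeff.
- rewrite -[cexp _]mul1r cE mulrA.
  under eq_fun => n do rewrite -[w ^+ n]mul1r.
  by rewrite termE; exact: cvg_Re_exp_series.
- rewrite ImE cE mulrA.
  under eq_fun => n do rewrite ImE.
  by rewrite termE; exact: cvg_Re_exp_series.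
Qed.

End ComplexExpectation.

Lemma measurable_preimage_nat {R : realType} d (T : measurableType d)
    (P : probability T R) (V : {RV P >-> nat}) (A : set nat) :
  measurable (V @^-1` A).
Proof. by rewrite -[X in measurable X]setTI; exact: measurable_funP. Qed.

(** * Variables independent of some of the inputs *)
Section Independence.
Context {R : realType} d (T : measurableType d) (P : probability T R).
Context (I : choiceType) (Y : I -> {RV P >-> nat}).
Implicit Types (D : set I) (E : set T) (J : {fset I}) (B : I -> set nat).

(** For mutually independent inputs, this is the independence of [E] from the family
of the [Y i] with [i] in [D]. The right-hand side is a product over the single
inputs, so that one of them can be moved from the family into [E]. *)
Definition event_independent D E : Prop := measurable E /\
  forall J, [set` J] `<=` D -> forall B,
    P (E `&` \bigcap_(i in [set` J]) Y i @^-1` B i) =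
      (P E * \prod_(i <- J) P (Y i @^-1` B i))%E.

Definition variable_independent D (C : Type) (U : T -> C) : Prop :=
  forall A : set C, event_independent D (U @^-1` A).

Lemma measurable_inputs J B : measurable (\bigcap_(i in [set` J]) Y i @^-1` B i).
Proof.
by apply: fin_bigcap_measurable => // i _; exact: measurable_preimage_nat.
Qed.

Lemma event_independent0 D : event_independent D set0.
Proof. by split=> // J _ B; rewrite set0I measure0 mul0e. Qed.

(** By countable additivity, both sides being sums over the values of [N]. *)
Lemma event_independent_fibers D E (N : T -> nat) :
  (forall n, event_independent D (E `&` N @^-1` [set n])) ->
  event_independent D E.
Proof.
move=> EN.
have EE : E = \bigcup_n (E `&` N @^-1` [set n]).
  by rewrite -setI_bigcupr bigcup_fibers setIT.
have tN : trivIset setT (fun n => E `&` N @^-1` [set n]).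
  exact/trivIset_setIl/trivIset_fibers.
have mE : measurable E by rewrite EE; apply: bigcup_measurable => n _; case: (EN n).
split=> // J JD B; set K := \bigcap_(i in _) _.
have mK : measurable K by exact: measurable_inputs.
have mEN n : measurable (E `&` N @^-1` [set n]) by case: (EN n).
have pfin : (\prod_(i <- J) P (Y i @^-1` B i))%E \is a fin_num.
  apply: (big_ind (fun x => x \is a fin_num)) => //; first exact: fin_numM.
  by move=> i _; apply: fin_num_measure; exact: measurable_preimage_nat.
rewrite [in LHS]EE setI_bigcupl [in RHS]EE !measure_semi_bigcup//; last 4 first.
- exact: bigcup_measurable.
- by move=> n; exact: measurableI.
- exact: trivIset_setIr.
- by apply: bigcup_measurable => n _; exact: measurableI.
rewrite muleC -(fineK pfin) -nneseriesZl//.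
by apply: eq_eseriesr => n _; rewrite fineK// muleC; case: (EN n) => _; exact.
Qed.

(** The code of [U] in [nat] is the variable along which the event is cut; on each
fiber the event [U @^-1` A] is empty or a fiber of [U]. *)
Lemma variable_independent_countable D (C : countType) (U : T -> C) :
  (forall c, event_independent D (U @^-1` [set c])) -> variable_independent D U.
Proof.
move=> Uc A.
apply: (@event_independent_fibers D _ (fun t => choice.pickle (U t))) => n.
have [[c [Ac cn]]|nc] := pselect (exists c : C, A c /\ choice.pickle c = n).
- rewrite (_ : _ `&` _ = U @^-1` [set c])//.
  apply/seteqP; split=> t /=; last by move=> ->.
  by rewrite -cn => -[_ /(pcan_inj choice.pickleK)].
- rewrite (_ : _ `&` _ = set0); first exact: event_independent0.
  by apply/seteqP; split=> t //= -[AU Un]; case: nc; exists (U t).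
Qed.

Lemma variable_independent_comp D (C C' : Type) (U : T -> C) (h : C -> C') :
  variable_independent D U -> variable_independent D (h \o U).
Proof. by move=> fU A; exact: (fU (h @^-1` A)). Qed.

Lemma probability_setI_input D (C : Type) (U : T -> C) i A A' :
    variable_independent D U -> D i ->
  P (U @^-1` A `&` Y i @^-1` A') = (P (U @^-1` A) * P (Y i @^-1` A'))%E.
Proof.
move=> fU Di; have [_ /(_ [fset i]%fset)] := fU A.
move=> /(_ _ (fun=> A')); rewrite big_seq_fset1 => <-.
  by rewrite set_fset1 bigcap_set1.
by rewrite set_fset1 => _ ->.
Qed.

(** An input can be absorbed into the past once it is removed from the family: on
rectangles, this is the independence of [U] from a family with one more
member. *)
Lemma variable_independent_pair D D' (C : countType) (U : T -> C) i :
    variable_independent D U -> D i -> D' `<=` D -> ~ D' i ->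
  variable_independent D' (fun t => (U t, Y i t)).
Proof.
move=> fU Di sD nD'i.
apply: variable_independent_countable => -[c m].
have -> : (fun t => (U t, Y i t)) @^-1` [set (c, m)] =
    U @^-1` [set c] `&` Y i @^-1` [set m].
  by apply/seteqP; split=> t /= [-> ->].
have [mU UE] := fU [set c].
split; first exact/measurableI/measurable_preimage_nat.
move=> J JD' B.
have iJ : i \notin J by apply/negP => iJ; apply/nD'i/JD'.
rewrite (probability_setI_input _ _ fU Di).
(* the sets [B], completed at the extra index [i] by the event [Y i = m] *)
pose B' j := if j == i then [set m] else B j.
have B'i : B' i = [set m] by rewrite /B' eqxx.
have B'J j : j \in J -> B' j = B j.
  by move=> jJ; rewrite /B'; case: eqP => // ji; move: iJ; rewrite -ji jJ.
have iJD : [set` (i |` J)%fset] `<=` D.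
  move=> j /=; rewrite in_fset1U => /orP[/eqP -> //|jJ]; exact/sD/JD'.
have capE : \bigcap_(j in [set` (i |` J)%fset]) Y j @^-1` B' j =
    Y i @^-1` [set m] `&` \bigcap_(j in [set` J]) Y j @^-1` B j.
  rewrite set_fsetU set_fset1 bigcap_setU bigcap_set1 B'i; congr (_ `&` _).
  by apply: eq_bigcapr => j /= jJ; rewrite B'J.
have := UE (i |` J)%fset iJD B'.
rewrite capE big_fsetU1//= B'i muleA setIA => ->; congr (_ * _)%E.
by apply: eq_big_seq => j jJ; rewrite B'J.
Qed.

End Independence.

(** The starting point of the construction: a constant is independent of all
inputs. *)
Lemma variable_independent_unit {R : realType} d (T : measurableType d)
    (P : probability T R) (I : choiceType) (Y : I -> {RV P >-> nat}) :
  mutually_independent Y -> variable_independent Y setT (fun=> tt).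
Proof.
move=> indep A; split; first by case: (pselect (A tt)) => At;
  [rewrite (_ : _ @^-1` _ = setT)|rewrite (_ : _ @^-1` _ = set0)] => //;
  apply/seteqP; split=> t //=.
move=> J _ B; have [At|At] := pselect (A tt).
- rewrite (_ : _ @^-1` A = setT); last by apply/seteqP; split=> t //=.
  by rewrite setTI probability_setT mul1e indep.
- rewrite (_ : _ @^-1` A = set0); last by apply/seteqP; split=> t //=.
  by rewrite set0I measure0 mul0e.
Qed.

(** * Comparing expectations along the values of a discrete variable *)
Section Fibers.
Context {R : realType} d (T : measurableType d) (P : probability T R).
Context (N : T -> nat) (mN : forall n, measurable (N @^-1` [set n])).
Implicit Types (Z W : T -> R[i]) (F G : T -> R).

Lemma integral_on_fiber F n :
  (\int[P]_t (F t * (N t == n)%:R)%:E = \int[P]_(t in N @^-1` [set n]) (F t)%:E)%E.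
Proof.
rewrite [RHS]integral_mkcond; apply: eq_integral => t _; rewrite patchE.
case: ifPn => [/set_mem /= ->|/negP nt]; first by rewrite eqxx mulr1.
by case: eqP => [tn|_]; [case: nt; exact/mem_set|rewrite mulr0].
Qed.

Lemma measurable_fiber n : measurable_fun setT (fun t => (N t == n)%:R : R).
Proof. exact: (measurable_nat_comp (fun m => (m == n)%:R : R) mN). Qed.

Lemma Re_mul_bool (z : R[i]) (b : bool) : Re (z * b%:R) = Re z * b%:R.
Proof. by case: b; rewrite ?mulr1 ?mulr0. Qed.

Lemma Im_mul_bool (z : R[i]) (b : bool) : Im (z * b%:R) = Im z * b%:R.
Proof. by case: b; rewrite ?mulr1 ?mulr0. Qed.

Lemma integrable_fiber F n : P.-integrable setT (fun t => (F t)%:E) ->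
  P.-integrable setT (fun t => (F t * (N t == n)%:R)%:E).
Proof.
move=> iF; apply: (le_integrable _ _ _ iF) => //.
- apply/measurable_EFinP/measurable_funM; last exact: measurable_fiber.
  exact/measurable_EFinP/(measurable_int _ iF).
- move=> t _; rewrite lee_fin normrM ler_piMr//.
  by case: (N t == n); rewrite ?normr1 ?normr0.
Qed.

Lemma cintegrable_fiber Z n : cintegrable P Z ->
  cintegrable P (fun t => Z t * (N t == n)%:R).
Proof.
move=> [iRe iIm]; split.
- by under eq_fun do rewrite Re_mul_bool; exact: integrable_fiber.
- by under eq_fun do rewrite Im_mul_bool; exact: integrable_fiber.
Qed.

Lemma eq_integral_fibers F G :
    P.-integrable setT (fun t => (F t)%:E) ->
    P.-integrable setT (fun t => (G t)%:E) ->
    (forall n, Rintegral P setT (fun t => F t * (N t == n)%:R) =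
               Rintegral P setT (fun t => G t * (N t == n)%:R)) ->
  Rintegral P setT F = Rintegral P setT G.
Proof.
move=> iF iG FG; rewrite /Rintegral (integral_fibers mN)// (integral_fibers mN iG).
congr fine; apply: eq_eseriesr => n _; rewrite -!integral_on_fiber.
rewrite -[LHS]fineK ?integrable_fin_num//; last exact: integrable_fiber.
rewrite -[RHS]fineK ?integrable_fin_num//; last exact: integrable_fiber.
by congr (_%:E); exact: FG.
Qed.

(** Integrability is what makes each side the sum of its restrictions to the
fibers. *)
Lemma eq_cexpectation_fibers Z W : cintegrable P Z -> cintegrable P W ->
    (forall n, cexpectation P (fun t => Z t * (N t == n)%:R) =
               cexpectation P (fun t => W t * (N t == n)%:R)) ->
  cexpectation P Z = cexpectation P W.
Proof.
move=> [ZRe ZIm] [WRe WIm] ZW; apply: eq_ReIm.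
- rewrite !Re_cexpectation; apply: eq_integral_fibers => // n.
  have /(congr1 (@complex.Re R)) := ZW n; rewrite !Re_cexpectation.
  by under eq_Rintegral do rewrite Re_mul_bool;
    under [RHS]eq_Rintegral do rewrite Re_mul_bool.
- rewrite !Im_cexpectation; apply: eq_integral_fibers => // n.
  have /(congr1 (@complex.Im R)) := ZW n; rewrite !Im_cexpectation.
  by under eq_Rintegral do rewrite Im_mul_bool;
    under [RHS]eq_Rintegral do rewrite Im_mul_bool.
Qed.

Lemma cintegrable_dominated Z W :
    measurable_fun setT (fun t => Re (Z t)) ->
    measurable_fun setT (fun t => Im (Z t)) ->
    (forall t, normc (Z t) <= Re (W t)) -> cintegrable P W -> cintegrable P Z.
Proof.
move=> mRe mIm ZW [iW _]; split; apply: (le_integrable _ _ _ iW) => //.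
- exact/measurable_EFinP.
- move=> t _; rewrite lee_fin (le_trans (norm_Re_le_normc _))//.
  by rewrite (le_trans (ZW t))// ler_norm.
- exact/measurable_EFinP.
- move=> t _; rewrite lee_fin (le_trans (norm_Im_le_normc _))//.
  by rewrite (le_trans (ZW t))// ler_norm.
Qed.

(** For nonnegative functions the sum over the fibers is legitimate before any
integrability is known, so the integral of [F] is that of [G], hence finite. *)
Lemma cintegrable_fibers F G : measurable_fun setT F ->
    (forall t, 0 <= F t) -> (forall t, 0 <= G t) ->
    cintegrable P (fun t => (G t)%:C) ->
    (forall n, cintegrable P (fun t => (F t)%:C * (N t == n)%:R) /\
       cexpectation P (fun t => (F t)%:C * (N t == n)%:R) =
       cexpectation P (fun t => (G t)%:C * (N t == n)%:R)) ->
  cintegrable P (fun t => (F t)%:C).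
Proof.
move=> mF F0 G0 [iG _] FG.
have iF : P.-integrable setT (fun t => (F t)%:E).
  apply/integrableP; split; first exact/measurable_EFinP.
  have /integrableP[_] := iG; apply: le_lt_trans.
  have absE (h : T -> R) : (forall t, 0 <= h t) ->
      (\int[P]_t `|(h t)%:E| = \int[P]_t (h t)%:E)%E.
    by move=> h0; apply: eq_integral => t _; rewrite gee0_abs// lee_fin.
  rewrite (absE F F0) [leRHS](absE G G0).
  rewrite (ge0_integral_fibers P mN); last 2 first.
    exact/measurable_EFinP.
    by move=> t; rewrite lee_fin.
  rewrite (ge0_integral_fibers P mN); last 2 first.
    exact: (measurable_int _ iG).
    by move=> t; rewrite lee_fin.
  rewrite le_eqVlt; apply/orP; left; apply/eqP; apply: eq_eseriesr => n _.
  rewrite -!integral_on_fiber; have [[iFn _] /(congr1 (@complex.Re R))] := FG n.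
  rewrite !Re_cexpectation => FGn.
  rewrite -[LHS]fineK ?integrable_fin_num//; last first.
    by move: iFn; under eq_fun do rewrite Re_mul_bool.
  rewrite -[RHS]fineK ?integrable_fin_num//; last exact: integrable_fiber.
  congr (_%:E); move: FGn; under eq_Rintegral do rewrite Re_mul_bool.
  by under [X in _ = X -> _]eq_Rintegral do rewrite Re_mul_bool.
split=> //=; exact: integrable0.
Qed.

End Fibers.

(** * The thinning recursion *)

(** The coefficients [D] of the exponent. Absorbing the factor
[1 + alpha * (z j.+1 - 1)] into [z j], and multiplying by the Poisson generating
function, adds to the exponent a multiple of [z j.+1 - 1]: the recursion gives
this multiple, up to the common factor [lambda / (1 - alpha)]. *)
Fixpoint weight {R : realType} (alpha : R) (z : nat -> R[i]) (k : nat) : R[i] :=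
  if k is j.+1 then 1 + alpha%:C * (z j * weight alpha z j - 1) else 1.

Lemma eq_weight {R : realType} (alpha : R) (z z' : nat -> R[i]) k :
  (forall i, (i < k)%N -> z i = z' i) -> weight alpha z k = weight alpha z' k.
Proof.
elim: k => [//|k ih] zz' /=; rewrite zz'// ih// => i ik; apply: zz'.
exact: ltn_trans ik _.
Qed.

Definition monomial {R : realType} (z : nat -> R[i]) (k : nat) (s : seq nat) :
    R[i] :=
  \prod_(i < k.+1) z i ^+ nth 0%N s i.

Section Process.
Context {R : realType} d (T : measurableType d) (P : probability T R).
Context (alpha lambda : R) (X0 : {RV P >-> nat}) (xi : nat -> nat -> {RV P >-> nat}).
Context (eps : nat -> {RV P >-> nat}).
Hypotheses (alpha01 : 0 < alpha < 1) (lambda_gt0 : 0 < lambda).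
Hypothesis indep : mutually_independent (inar_inputs X0 xi eps).
Hypothesis xi_law : forall k j : nat,
  distribution P (xi k j) [set 1%N] = alpha%:E /\
  distribution P (xi k j) [set 0%N] = (1 - alpha)%:E.
Hypothesis eps_law : forall k : nat, poisson_distributed (eps k) lambda.
Hypothesis X0_law : poisson_distributed X0 ((1 - alpha)^-1 * lambda).

Local Notation X := (inar X0 xi eps).
Local Notation Y := (inar_inputs X0 xi eps).

(** The inputs that do not enter [X 0, ..., X k] nor the first [r] summands of the
thinning that produces [X k.+1]. *)
Definition pending (k r : nat) : set (option (nat * nat + nat)) :=
  [set i | match i with
           | None => False
           | Some (inl (l, j)) => (k < l)%N \/ l = k /\ (r <= j)%N
           | Some (inr l) => (k <= l)%N
           end].

Definition history (k : nat) (t : T) : seq nat := mkseq (fun i => X i t) k.+1.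

Definition thinned (k r : nat) (t : T) : nat := \sum_(j < r) xi k j t.

Lemma last_history x k t : last x (history k t) = X k t.
Proof.
rewrite /history (last_nth 0%N) size_mkseq.
by rewrite -[RHS](nth_mkseq 0%N (fun i => X i t) (ltnSn k)).
Qed.

Lemma history_thinned_independent k :
    variable_independent Y (pending k 0) (history k) -> forall r,
  variable_independent Y (pending k r) (fun t => (history k t, thinned k r t)).
Proof.
move=> fH; elim=> [|r ih].
  have := variable_independent_comp (fun s : seq nat => (s, 0%N)) fH.
  congr (variable_independent _ _ _); apply/funext => t /=.
  by rewrite /thinned big_ord0.
pose h (u : seq nat * nat * nat) := (u.1.1, (u.1.2 + u.2)%N).
rewrite (_ : (fun t => _) =
    h \o (fun t => (history k t, thinned k r t, xi k r t))); last first.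
  by apply/funext => t; rewrite /h /= /thinned big_ord_recr.
apply: variable_independent_comp.
apply: (@variable_independent_pair _ _ _ _ _ Y (pending k r) _ _ _
  (Some (inl (k, r)))) => //=.
- by right.
- move=> [[[l j]|l]|]//= [kl|[-> rj]]; [by left|right; split=> //; exact: ltnW].
- by case=> [|[_]]; rewrite ltnn.
Qed.

Lemma history_step_independent k r :
    variable_independent Y (pending k 0) (history k) ->
  variable_independent Y (pending k.+1 0)
    (fun t => (history k t, thinned k r t + eps k t)%N).
Proof.
move=> fH.
pose h (u : seq nat * nat * nat) := (u.1.1, (u.1.2 + u.2)%N).
rewrite (_ : (fun t => _) =
  h \o (fun t => (history k t, thinned k r t, eps k t)))//.
apply: variable_independent_comp.
apply: (@variable_independent_pair _ _ _ _ _ Y (pending k r) _ _ _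
  (Some (inr k))) => //=.
- exact: history_thinned_independent.
- move=> [[[l j]|l]|]//= => [[kl|[-> _]]|/ltnW//]; left => //; exact: ltnW.
- by rewrite ltnn.
Qed.

(** The number [X k] of summands in [X k.+1] is itself random. On the event
[X k = n] the new history is a function of the old one and of a sum with a fixed
number [n] of terms, and [event_independent_fibers] puts the events together. *)
Lemma history_independent k : variable_independent Y (pending k 0) (history k).
Proof.
elim: k => [|k ih].
  rewrite (_ : history 0 =
    (fun u : unit * nat => [:: u.2]) \o (fun t => (tt, X0 t)))//.
  apply: variable_independent_comp.
  apply: (@variable_independent_pair _ _ _ _ _ Y setT _ _ (fun=> tt) None) => //.
  exact: variable_independent_unit.
move=> A; apply: (@event_independent_fibers _ _ _ _ _ Y _ _ (X k)) => n.
pose A' := [set u : seq nat * nat | A (rcons u.1 u.2) /\ last 0%N u.1 = n].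
have := @history_step_independent k n ih A'; congr (event_independent _ _ _).
have historyS t :
    history k.+1 t = rcons (history k t) (thinned k (X k t) t + eps k t)%N.
  by rewrite /history mkseqS.
apply/seteqP; split=> t [At Xn].
- have Xn' : X k t = n by rewrite -Xn; exact/esym/last_history.
  by split=> //; rewrite /preimage /mkset historyS Xn'.
- split; last by rewrite -[RHS]Xn; exact: last_history.
  by move: At; rewrite /preimage /mkset historyS [X k t]Xn.
Qed.

Lemma measurable_inar_fiber k n : measurable (X k @^-1` [set n]).
Proof.
have -> : X k = last 0%N \o history k.
  by apply/funext => t; exact/esym/last_history.
by have [] := history_independent k (last 0%N @^-1` [set n]).
Qed.

(** The summands enter one at a time, each independent of the history and of the
summands before it, and each contributes the Bernoulli generating function. *)
Lemma thinned_generator k (f : seq nat -> R[i]) w r :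
    cintegrable P (f \o history k) ->
  cintegrable P (fun t => f (history k t) * w ^+ thinned k r t) /\
  cexpectation P (fun t => f (history k t) * w ^+ thinned k r t) =
    cexpectation P (f \o history k) * (1 + alpha%:C * (w - 1)) ^+ r.
Proof.
move=> iF; elim: r => [|r [ih1 ih2]].
  rewrite expr0 mulr1 (_ : (fun t => _) = f \o history k)//.
  by apply/funext => t; rewrite /thinned big_ord0 mulr1.
rewrite exprSr mulrA -ih2.
have [iw <-] := bernoulli_generator w
  (fun n => measurable_preimage_nat (xi k r) [set n]) (xi_law k r).1 (xi_law k r).2.
pose g (u : seq nat * nat) := f u.1 * w ^+ u.2.
have [] := @cexpectation_independent _ _ _ P _ _
   (fun t => (history k t, thinned k r t)) (xi k r) g (fun n => w ^+ n) _ ih1 iw.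
  move=> A B; apply: (probability_setI_input (Y := Y) (i := Some (inl (k, r)))).
    exact/history_thinned_independent/history_independent.
  by right.
rewrite (_ : (fun t => g _ * _) =
  (fun t => f (history k t) * w ^+ thinned k r.+1 t)) => [//|].
by apply/funext => t; rewrite /g /= /thinned big_ord_recr/= exprD mulrA.
Qed.

Lemma innovated_generator k (f : seq nat -> R[i]) w r :
    cintegrable P (f \o history k) ->
  cintegrable P (fun t => f (history k t) * w ^+ (thinned k r t + eps k t)) /\
  cexpectation P (fun t => f (history k t) * w ^+ (thinned k r t + eps k t)) =
    cexpectation P (f \o history k) * (1 + alpha%:C * (w - 1)) ^+ r
    * cexp (lambda%:C * (w - 1)).
Proof.
move=> iF; have [ih1 <-] := thinned_generator w r iF.
have [iw <-] := poisson_generator w lambda_gt0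
  (fun n => measurable_preimage_nat (eps k) [set n]) (eps_law k).
pose g (u : seq nat * nat) := f u.1 * w ^+ u.2.
have [] := @cexpectation_independent _ _ _ P _ _
   (fun t => (history k t, thinned k r t)) (eps k) g (fun n => w ^+ n) _ ih1 iw.
  move=> A B; apply: (probability_setI_input (Y := Y) (i := Some (inr k))).
    exact/(@history_thinned_independent _ _ r)/history_independent.
  by rewrite /pending /=.
rewrite (_ : (fun t => g _ * _) =
  (fun t => f (history k t) * w ^+ (thinned k r t + eps k t))) => [//|].
by apply/funext => t; rewrite /g /= exprD mulrA.
Qed.

Lemma measurable_of_history (h : seq nat -> R) (F : T -> R) k :
  (forall t, F t = h (history k t)) -> measurable_fun setT F.
Proof.
move=> /funext -> _ B mB; rewrite setTI.
by have [] := history_independent k (h @^-1` B).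
Qed.

(** On [X k = n] the number of summands in [X k.+1] is the constant [n], so the
indicator of that event can be treated as a function of the history. *)
Lemma transition_on_fiber k (f : seq nat -> R[i]) w n :
    cintegrable P (f \o history k) ->
  cintegrable P (fun t => f (history k t) * w ^+ X k.+1 t * (X k t == n)%:R) /\
  cexpectation P (fun t => f (history k t) * w ^+ X k.+1 t * (X k t == n)%:R) =
  cexpectation P (fun t => cexp (lambda%:C * (w - 1)) *
     (f (history k t) * (1 + alpha%:C * (w - 1)) ^+ X k t) * (X k t == n)%:R).
Proof.
move=> iF; pose fn s := f s * (last 0%N s == n)%:R.
have fnE t : fn (history k t) = f (history k t) * (X k t == n)%:R.
  by rewrite /fn last_history.
have ifn : cintegrable P (fn \o history k).
  rewrite (_ : fn \o _ = (fun t => f (history k t) * (X k t == n)%:R)).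
    exact: (cintegrable_fiber (measurable_inar_fiber k) n iF).
  by apply/funext => t; exact: fnE.
have [] := innovated_generator w n ifn.
rewrite (_ : (fun t => fn _ * _) =
  (fun t => f (history k t) * w ^+ X k.+1 t * (X k t == n)%:R))
  => [ifw ->|]; last first.
  apply/funext => t; rewrite fnE /=.
  by case: (altP (X k t =P n)) => [<-|_]; rewrite ?mulr1 ?mulr0 ?mul0r.
split=> //; set b := 1 + _; set c := cexp _.
rewrite (_ : (fun t => c * _ * _) = (fun t => c * b ^+ n * (fn \o history k) t)).
  by rewrite cexpectationZ//; ring.
apply/funext => t; rewrite /= fnE.
by case: (altP (X k t =P n)) => [<-|_]; rewrite ?mulr1 ?mulr0//; ring.
Qed.

(** The hypotheses with [normc] are the first and the third one for the absolute
values; they provide an integrable majorant of the product with [w ^+ X k.+1]. *)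
Lemma transition_generator k (f : seq nat -> R[i]) w :
    cintegrable P (f \o history k) ->
    cintegrable P (fun t => (normc (f (history k t)))%:C) ->
    cintegrable P (fun t => f (history k t) * (1 + alpha%:C * (w - 1)) ^+ X k t) ->
    cintegrable P (fun t => (normc (f (history k t)))%:C *
                            (1 + alpha%:C * ((normc w)%:C - 1)) ^+ X k t) ->
  cintegrable P (fun t => f (history k t) * w ^+ X k.+1 t) /\
  cexpectation P (fun t => f (history k t) * w ^+ X k.+1 t) =
    cexp (lambda%:C * (w - 1)) *
    cexpectation P (fun t => f (history k t) * (1 + alpha%:C * (w - 1)) ^+ X k t).
Proof.
move=> i1 i2 i3 i4; set rho := normc w in i4 *.
have mX := measurable_inar_fiber k.
have fE t : f (history k t) = f (take k.+1 (history k.+1 t)).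
  by rewrite /history [in RHS]mkseqS -cats1 take_size_cat// size_mkseq.
(* The sum of [1 - alpha] and [alpha * rho]. *)
have b0 : 0 <= 1 + alpha * (rho - 1).
  have /andP[? ?] := alpha01; have := normc_ge0 w; rewrite -/rho; nra.
have iabs : cintegrable P (fun t => (normc (f (history k t)) * rho ^+ X k.+1 t)%:C).
  apply: (@cintegrable_fibers _ _ _ P _ mX
    (fun t => normc (f (history k t)) * rho ^+ X k.+1 t)
    (fun t => expR (lambda * (rho - 1)) *
       (normc (f (history k t)) * (1 + alpha * (rho - 1)) ^+ X k t))).
  - apply: (@measurable_of_history
      (fun s => normc (f (take k.+1 s)) * rho ^+ last 0%N s) _ k.+1) => t.
    by rewrite -fE last_history.
  - by move=> t; rewrite mulr_ge0 ?exprn_ge0 ?normc_ge0.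
  - by move=> t; rewrite !mulr_ge0 ?expR_ge0 ?exprn_ge0 ?normc_ge0.
  - have := cintegrableZ (expR (lambda * (rho - 1)))%:C i4.
    congr (cintegrable _ _); apply/funext => t.
    by rewrite !(rmorphM, rmorphXn, rmorphD, rmorphB, rmorphN, rmorph1).
  - move=> n.
    have [ifib Efib] :=
      @transition_on_fiber k (fun s => (normc (f s))%:C) rho%:C n i2.
    have eqF t : (normc (f (history k t)))%:C * rho%:C ^+ X k.+1 t =
        (normc (f (history k t)) * rho ^+ X k.+1 t)%:C.
      by rewrite rmorphM rmorphXn.
    have eqG t : cexp (lambda%:C * (rho%:C - 1)) *
        ((normc (f (history k t)))%:C * (1 + alpha%:C * (rho%:C - 1)) ^+ X k t) =
        (expR (lambda * (rho - 1)) *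
           (normc (f (history k t)) * (1 + alpha * (rho - 1)) ^+ X k t))%:C.
      rewrite (_ : lambda%:C * _ = (lambda * (rho - 1))%:C) ?cexp_real.
        by rewrite !(rmorphM, rmorphXn, rmorphD, rmorphB, rmorphN, rmorph1).
      by rewrite !(rmorphM, rmorphXn, rmorphD, rmorphB, rmorphN, rmorph1).
    split.
    + by move: ifib; congr (cintegrable _ _); apply/funext => t; rewrite eqF.
    + transitivity (cexpectation P (fun t => (normc (f (history k t)))%:C *
          rho%:C ^+ X k.+1 t * (X k t == n)%:R)).
        by congr (cexpectation _ _); apply/funext => t; rewrite eqF.
      by rewrite Efib; congr (cexpectation _ _); apply/funext => t; rewrite eqG.
have ifw : cintegrable P (fun t => f (history k t) * w ^+ X k.+1 t).
  apply: cintegrable_dominated iabs.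
  - apply: (@measurable_of_history
      (fun s => Re (f (take k.+1 s) * w ^+ last 0%N s)) _ k.+1) => t.
    by rewrite -fE last_history.
  - apply: (@measurable_of_history
      (fun s => Im (f (take k.+1 s) * w ^+ last 0%N s)) _ k.+1) => t.
    by rewrite -fE last_history.
  - by move=> t; rewrite Normc.normcM normcX.
split=> //.
rewrite -cexpectationZ//; apply: (eq_cexpectation_fibers mX) => //.
  exact: cintegrableZ.
by move=> n; have [] := transition_on_fiber w n i1.
Qed.

Lemma monomial_history (z : nat -> R[i]) k t :
  monomial z k (history k t) = \prod_(i < k.+1) z i ^+ X i t.
Proof. by apply: eq_bigr => i _; rewrite /history nth_mkseq. Qed.

(** The induction is over all [z] at once: the step from [k] to [k.+1] uses the
formula for [k] at a modified [z], and integrability for [k] at the absolute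
values. *)
Lemma monomial_expectation k (z : nat -> R[i]) :
  cintegrable P (fun t => monomial z k (history k t)) /\
  cexpectation P (fun t => monomial z k (history k t)) =
    cexp ((lambda / (1 - alpha))%:C * \sum_(j < k.+1) weight alpha z j * (z j - 1)).
Proof.
elim: k z => [|k ih] z.
  have l0 : 0 < (1 - alpha)^-1 * lambda.
    by rewrite mulr_gt0// invr_gt0 subr_gt0; case/andP: alpha01.
  rewrite big_ord1 /= mul1r [lambda / _]mulrC.
  rewrite (_ : (fun t => _) = (fun t => z 0%N ^+ X0 t)).
    have mX0 n := measurable_preimage_nat X0 [set n].
    exact: (poisson_generator _ l0 mX0 X0_law).
  by apply/funext => t; rewrite monomial_history big_ord1.
pose b w : R[i] := 1 + alpha%:C * (w - 1).
pose absorb (y : nat -> R[i]) w i := if i == k then y k * b w else y i.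
have absorbE y w t : monomial (absorb y w) k (history k t) =
    monomial y k (history k t) * b w ^+ X k t.
  rewrite !monomial_history !big_ord_recr /= /absorb eqxx exprMn mulrA.
  congr (_ * _ * _).
  by apply: eq_bigr => i _; rewrite ltn_eqF.
pose absz i : R[i] := (normc (z i))%:C.
have abszE t :
    monomial absz k (history k t) = (normc (monomial z k (history k t)))%:C.
  rewrite /monomial; elim/big_rec2: _ => [|i y1 y2 _ ->].
    by rewrite Normc.normc1.
  by rewrite Normc.normcM normcX rmorphM rmorphXn.
have [] := @transition_generator k (monomial z k) (z k.+1).
- by have [] := ih z.
- have [+ _] := ih absz; congr (cintegrable _ _); apply/funext => t; exact: abszE.
- have [+ _] := ih (absorb z (z k.+1)); congr (cintegrable _ _).
  by apply/funext => t; exact: absorbE.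
- have [+ _] := ih (absorb absz (absz k.+1)); congr (cintegrable _ _).
  by apply/funext => t; rewrite absorbE abszE.
rewrite (_ : (fun t => monomial z k (history k t) * z k.+1 ^+ X k.+1 t) =
  (fun t => monomial z k.+1 (history k.+1 t))); last first.
  by apply/funext => t; rewrite !monomial_history [RHS]big_ord_recr.
move=> iz ->; split=> //.
have -> :
  cexpectation P (fun t => monomial z k (history k t) * b (z k.+1) ^+ X k t) =
    cexpectation P (fun t => monomial (absorb z (z k.+1)) k (history k t)).
  by congr (cexpectation _ _); apply/funext => t; rewrite absorbE.
rewrite (ih _).2 -cexpD; congr cexp.
have la : lambda%:C = (lambda / (1 - alpha))%:C * (1 - alpha)%:C.
  by rewrite -rmorphM divfK// subr_eq0 gt_eqF//; case/andP: alpha01.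
rewrite [in X in X + _]la -mulrA -mulrDr; congr (_ * _).
have wE j : (j <= k)%N -> weight alpha (absorb z (z k.+1)) j = weight alpha z j.
  move=> jk; apply: eq_weight => i ij; rewrite /absorb ltn_eqF//.
  exact: leq_trans ij jk.
have zk : absorb z (z k.+1) k = z k * b (z k.+1) by rewrite /absorb eqxx.
have zlt i : (i < k)%N -> absorb z (z k.+1) i = z i.
  by move=> ik; rewrite /absorb ltn_eqF.
rewrite !big_ord_recr /= wE// zk.
rewrite (eq_bigr (fun i : 'I_k => weight alpha z i * (z i - 1))); last first.
  by move=> i _; rewrite zlt// wE// ltnW.
set S := \sum_(i < k) _; rewrite /b rmorphB rmorph1; ring.
Qed.

End Process.

(** * Closed forms of the exponent *)
Section ClosedForms.
Context {R : realType} (alpha : R).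
Implicit Types (z : nat -> R[i]) (i j k : nat).

Lemma weightE z k : weight alpha z k =
  1 + \sum_(i < k) (alpha ^+ (k - i))%:C * (z i - 1) * \prod_(i.+1 <= l < k) z l.
Proof.
elim: k => [|k ih]; first by rewrite big_ord0 addr0.
rewrite /= ih; set S := \sum_(i < k) _.
rewrite big_ord_recr /= subSnn expr1 big_geq// mulr1.
rewrite (eq_bigr (fun i : 'I_k => alpha%:C * z k *
  ((alpha ^+ (k - i))%:C * (z i - 1) * \prod_(i.+1 <= l < k) z l))); last first.
  move=> i _; rewrite subSn 1?ltnW// exprS rmorphM big_nat_recr//=; ring.
rewrite -mulr_sumr -/S; ring.
Qed.

Lemma weight_chains z j :
  weight alpha z j * (z j - 1) = \sum_(i < j.+1) (alpha ^+ (j - i))%:C *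
    (if i == j :> nat then z i - 1
     else (z i - 1) * \prod_(i.+1 <= l < j) z l * (z j - 1)).
Proof.
rewrite big_ord_recr /= eqxx subnn expr0 mul1r weightE addrC mulrDl mul1r.
congr (_ + _).
rewrite mulr_suml; apply: eq_bigr => i _; rewrite ltn_eqF// -!mulrA.
by congr (_ * _); rewrite !mulrA.
Qed.

Hypothesis alpha_lt1 : alpha < 1.

(** The recursion read for [z j * weight z j]: passing from [j] to [j.+1]
multiplies each block ending at [j] by [alpha * z j.+1], and starts the block
reduced to [z j.+1]. *)
Lemma weight_blocks z j : z j * weight alpha z j = (1 - alpha)%:C *
  \sum_(i < j.+1) ((1 - alpha) ^ Kexp i j j * alpha ^+ (j - i))%:C *
    \prod_(i <= l < j.+1) z l.
Proof.
have nz : 1 - alpha != 0 by rewrite subr_eq0 gt_eqF.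
elim: j => [|j ih].
  by rewrite big_ord1 /Kexp /= big_nat1 !mulr1 mulrA -rmorphM mulfV// mul1r.
rewrite big_ord_recr /= /Kexp /= eqxx expr0z subnn expr0 mulr1 mul1r big_nat1.
rewrite (eq_bigr (fun i : 'I_j.+1 => alpha%:C * z j.+1 *
  (((1 - alpha) ^ Kexp i j j * alpha ^+ (j - i))%:C *
   \prod_(i <= l < j.+1) z l))); last first.
  move=> i _; rewrite subSn -1?ltnS// exprS (big_nat_recr j.+1)//=; last exact: ltnW.
  by rewrite /Kexp !eqxx !rmorphM /=; ring.
rewrite -mulr_sumr; move: ih; set S := \sum_(i < _) _ => ih.
rewrite ih rmorphB rmorph1; ring.
Qed.

Lemma weight_one k : weight alpha (fun=> 1) k = 1.
Proof. by elim: k => [//|k /= ->]; rewrite mulr1 subrr mulr0 addr0. Qed.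

(** Summation by parts: by the recursion, [weight z j.+1 - 1] is [alpha] times
[z j * weight z j - 1]. *)
Lemma weight_sum z k :
  \sum_(j < k.+1) weight alpha z j * (z j - 1) =
  (1 - alpha)%:C * \sum_(j < k) (z j * weight alpha z j - 1) +
    (z k * weight alpha z k - 1).
Proof.
elim: k => [|k ih]; first by rewrite big_ord1 big_ord0 /= mulr0 add0r mul1r mulr1.
rewrite big_ord_recr /= ih [in RHS]big_ord_recr /= rmorphB rmorph1.
set S := \sum_(j < k) _; ring.
Qed.

(** The exponent [Kexp i j k] exceeds [Kexp i j j] by one when [j < k], which is
the factor [1 - alpha] in front of the first sum in [weight_sum]. *)
Lemma weight_sum_blocks z k :
  \sum_(j < k.+1) weight alpha z j * (z j - 1) = (1 - alpha)%:C *
    \sum_(j < k.+1) \sum_(i < j.+1)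
      ((1 - alpha) ^ Kexp i j k * alpha ^+ (j - i))%:C *
      (\prod_(i <= l < j.+1) z l - 1).
Proof.
have nz : 1 - alpha != 0 by rewrite subr_eq0 gt_eqF.
have blockE j : z j * weight alpha z j - 1 = (1 - alpha)%:C *
    \sum_(i < j.+1) ((1 - alpha) ^ Kexp i j j * alpha ^+ (j - i))%:C *
       (\prod_(i <= l < j.+1) z l - 1).
  (* At [z = 1] the coefficients of the blocks sum to [(1 - alpha)^-1], which
     accounts for the [- 1] attached to each block. *)
  have := weight_blocks (fun=> 1) j; rewrite weight_one mulr1 weight_blocks => {2}->.
  rewrite -mulrBr -sumrB; congr (_ * _); apply: eq_bigr => i _.
  by rewrite [X in _ - _ * X]big1// mulrBr.
rewrite weight_sum big_ord_recr /= mulrDr -blockE; congr (_ + _).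
congr (_ * _); apply: eq_bigr => j _; rewrite blockE mulr_sumr.
apply: eq_bigr => i _; rewrite mulrA -rmorphM mulrA; congr (_%:C * _); congr (_ * _).
rewrite /Kexp eqxx (ltn_eqF (ltn_ord j)).
by case: (_ == 0)%N; rewrite ?mulfV ?expr0z ?mulr1 ?expr1z.
Qed.

End ClosedForms.

Lemma prod_between {R : realType} k (z : 'I_k.+1 -> R[i]) (a b : nat) :
    (b <= k.+1)%N ->
  \prod_(l < k.+1 | (a <= l < b)%N) z l = \prod_(a <= l < b) z (inord l).
Proof.
move=> bk; rewrite (big_nat_widen _ _ _ _ _ bk) big_geq_mkord /=.
by apply: eq_big => [l|l _]; [rewrite andbC|rewrite inord_val].
Qed.

Lemma sum_triangle {R : realType} k (c : nat -> nat -> R[i]) :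
  \sum_(i < k.+1) \sum_(j < k.+1 | (i <= j)%N) c i j =
  \sum_(j < k.+1) \sum_(i < j.+1) c i j.
Proof.
rewrite (exchange_big_dep xpredT)//=; apply: eq_bigr => j _.
by rewrite (big_ord_widen k.+1 (fun i => c i j)).
Qed.

Theorem proposition2p1 (R : realType) (d : measure_display)
    (T : measurableType d) (P : probability T R) (alpha lambda : R)
    (X0 : {RV P >-> nat}) (xi : nat -> nat -> {RV P >-> nat})
    (eps : nat -> {RV P >-> nat})
    (alpha01 : 0 < alpha < 1) (lambda_gt0 : 0 < lambda)
    (indep : mutually_independent (inar_inputs X0 xi eps))
    (xi_law : forall k j : nat,
      distribution P (xi k j) [set 1%N] = alpha%:E /\
      distribution P (xi k j) [set 0%N] = (1 - alpha)%:E)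
    (eps_law : forall k : nat, poisson_distributed (eps k) lambda)
    (X0_law : poisson_distributed X0 ((1 - alpha)^-1 * lambda))
    (k : nat) (z : 'I_k.+1 -> R[i]) :
  let X : nat -> T -> nat := inar X0 xi eps in
  [/\ cintegrable P (joint_monomial X z),
      joint_generator P X z =
        cexp ((lambda / (1 - alpha))%:C *
              \sum_(i < k.+1) \sum_(j < k.+1 | (i <= j)%N)
                (alpha ^+ (j - i))%:C * chain_term z i j)
    & joint_generator P X z =
        cexp (lambda%:C *
              \sum_(i < k.+1) \sum_(j < k.+1 | (i <= j)%N)
                ((1 - alpha) ^ Kexp i j k * alpha ^+ (j - i))%:C *
                (\prod_(l < k.+1 | (i <= l <= j)%N) z l - 1))].
Proof.
move=> X; pose zn i := z (inord i).
have znE (l : 'I_k.+1) : zn l = z l by rewrite /zn inord_val.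
have [iz Ez] :=
  monomial_expectation alpha01 lambda_gt0 indep xi_law eps_law X0_law k zn.
have alpha_lt1 : alpha < 1 by case/andP: alpha01.
have monoE : joint_monomial X z = (fun t => monomial zn k (history X0 xi eps k t)).
  apply/funext => t; rewrite monomial_history; apply: eq_bigr => i _.
  by rewrite znE.
rewrite /joint_generator monoE Ez; split=> //; congr cexp.
- congr (_ * _).
  rewrite (eq_bigr _ (fun (j : 'I_k.+1) _ => weight_chains alpha zn j)).
  pose c i j := (alpha ^+ (j - i))%:C *
    (if i == j :> nat then zn i - 1
     else (zn i - 1) * \prod_(i.+1 <= l < j) zn l * (zn j - 1)).
  rewrite -(sum_triangle k c); apply: eq_bigr => i _; apply: eq_bigr => j _.
  rewrite /c /chain_term !znE; congr (_ * _).
  case: eqP => [/val_inj ->|nij]; first by rewrite eqxx.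
  by case: eqP => [ij|_]; [case: nij; rewrite ij|rewrite prod_between// ltnW].
- rewrite weight_sum_blocks// mulrA -rmorphM divfK ?subr_eq0 ?gt_eqF//.
  congr (_ * _).
  rewrite -(sum_triangle k (fun i j =>
    ((1 - alpha) ^ Kexp i j k * alpha ^+ (j - i))%:C *
    (\prod_(i <= l < j.+1) zn l - 1))).
  apply: eq_bigr => i _; apply: eq_bigr => j _; congr (_ * (_ - _)).
  by rewrite -prod_between.
Qed.
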